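(* Let $k\ge 1$ be a half-integer (i.e. $k-\frac12\in\mathbb{Z}$) and let $V_1\subseteq D_{int}$ be a set of stops. Then every point of $D_{edge}$ is within $\ell_1$ distance $k$ of some point of $V_1$ if and only if every point of $D_{int}$ is within $\ell_1$ distance $k-\frac12$ of some point of $V_1$.
   Context: Let $m\ge n\ge 1$ be integers, $D=\{(x,y)\in\mathbb{R}^2: 0\le x\le n,\ 0\le y\le m\}$, $D_{int}=D\cap\mathbb{Z}^2$ and $D_{edge}=\{(x,y)\in D: x\in\mathbb{Z}\text{ or }y\in\mathbb{Z}\}$. *)

(* Defs.v *)
From HB Require Import structures.
From mathcomp Require Import all_boot all_order all_algebra.
From mathcomp Require Import all_classical reals.

Set Implicit Arguments.
Unset Strict Implicit.
Unset Printing Implicit Defensive.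

Import Order.TTheory GRing.Theory Num.Theory.
Local Open Scope classical_set_scope.
Local Open Scope ring_scope.

Section Grid.
Variables (R : realType) (m n : nat).

(* [n] bounds the first coordinate and [m] the second one. *)
Definition D : set (R * R) :=
  [set p | 0 <= p.1 <= n%:R /\ 0 <= p.2 <= m%:R].

Definition D_int : set (R * R) :=
  D `&` [set p | p.1 \is a Num.int /\ p.2 \is a Num.int].

Definition D_edge : set (R * R) :=
  D `&` [set p | p.1 \is a Num.int \/ p.2 \is a Num.int].

End Grid.

(* The library norm on [R * R] is the sup norm, hence an explicit definition. *)
Definition l1dist (R : realType) (p q : R * R) : R :=
  `|p.1 - q.1| + `|p.2 - q.2|.

Definition covers (R : realType) (V A : set (R * R)) (r : R) : Prop :=
  forall p, A p -> exists2 v, V v & l1dist p v <= r.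

(* Main.v *)
Require Import Defs.
From HB Require Import structures.
From mathcomp Require Import all_boot all_order all_algebra.
From mathcomp Require Import all_classical reals.
From mathcomp Require Import lra.

Set Implicit Arguments.
Unset Strict Implicit.
Unset Printing Implicit Defensive.

Import Order.TTheory GRing.Theory Num.Theory.
Local Open Scope classical_set_scope.
Local Open Scope ring_scope.

(** Stops have integer coordinates, so their distance to any point of [D_int] is an integer; an
    integer at most the half-integer [k] is at most [k - 1/2] ([le_int_half]). As [D_int] lies in
    [D_edge], this gives one direction. Conversely, every edge point is within 1/2 of some point of
    [D_int] ([D_edge_near_D_int]), and the triangle inequality adds this 1/2 to [k - 1/2]. *)

Lemma l1dist_triangle (R : realType) (q p r : R * R) :
  l1dist p r <= l1dist p q + l1dist q r.
Proof. by rewrite /l1dist addrACA lerD // ler_distD. Qed.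

Lemma l1dist_int (R : realType) (p q : R * R) :
  p.1 \is a Num.int -> p.2 \is a Num.int ->
  q.1 \is a Num.int -> q.2 \is a Num.int -> l1dist p q \is a Num.int.
Proof.
have normZ (z : R) : z \is a Num.int -> `|z| \is a Num.int.
  by move=> /intrP[i ->]; rewrite -intr_norm intr_int.
by move=> p1 p2 q1 q2; rewrite rpredD // normZ // rpredB.
Qed.

Lemma le_int_half (R : realType) (a b : R) :
  a \is a Num.int -> b - 2%:R^-1 \is a Num.int ->
  a <= b -> a <= b - 2%:R^-1.
Proof.
move=> /intrP[i ->] /intrP[j jE] le_ib.
(* With [b = j + 1/2], the bound [i <= b] gives [i < j + 1], hence [i <= j] over the integers. *)
rewrite jE ler_int -ltzD1 -(ltr_int R) intrD; lra.
Qed.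

(** Rounding to the nearest integer, [floor (x + 1/2)], cannot leave the interval because both
    endpoints are integers. *)
Lemma nearest_int_itv (R : realType) (n : nat) (x : R) :
  0 <= x <= n%:R ->
  exists2 z : R, z \is a Num.int & 0 <= z <= n%:R /\ `|x - z| <= 2%:R^-1.
Proof.
move=> /andP[x0 xn]; pose z := Num.floor (x + 2%:R^-1).
have zle : z%:~R <= x + 2%:R^-1 by exact: floor_le.
have ltz : x + 2%:R^-1 < z%:~R + 1 by rewrite -[1]/(1%:~R) -intrD floorD1_gt.
exists z%:~R; first exact: intr_int.
split; last by rewrite ler_norml; lra.
(* The upper bound is turned into [x + 1/2 < n + 1], which follows from [x <= n]. *)
rewrite ler0z floor_ge0 (pmulrn _ n) ler_int -ltzD1 floor_lt_int intrD -(pmulrn _ n); lra.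
Qed.

(** One coordinate is already an integer, so only the other is rounded and only it contributes to
    the distance. *)
Lemma D_edge_near_D_int (R : realType) (m n : nat) (p : R * R) :
  D_edge m n p -> exists2 q, D_int m n q & l1dist p q <= 2%:R^-1.
Proof.
case: p => x y [[/= xD yD] [xZ|yZ]].
- have [z zZ [zD xz]] := nearest_int_itv yD.
  by exists (x, z) => //; rewrite /l1dist subrr normr0 add0r.
- have [z zZ [zD xz]] := nearest_int_itv xD.
  by exists (z, y) => //; rewrite /l1dist subrr normr0 addr0.
Qed.

Theorem proposition3 (R : realType) (m n : nat) (hn : (1 <= n)%N)
    (hmn : (n <= m)%N) (k : R) (hk1 : 1 <= k)
    (hk : k - 2%:R^-1 \is a Num.int)
    (V1 : set (R * R)) (hV1 : V1 `<=` D_int m n) :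
  covers V1 (D_edge m n) k <-> covers V1 (D_int m n) (k - 2%:R^-1).
Proof.
split=> [covE p [pD [p1 p2]]|covI p /D_edge_near_D_int[q qI pq]].
- have [v Vv pv] : exists2 v, V1 v & l1dist p v <= k.
    by apply: covE; split => //; left.
  have [_ [v1 v2]] := hV1 _ Vv.
  by exists v => //; apply: le_int_half => //; exact: l1dist_int.
- have [v Vv qv] := covI _ qI.
  exists v => //; apply: le_trans (l1dist_triangle q p v) _; lra.
Qed.
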